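(* Let $p>1$. For any $H\in\mathscr H\setminus\{0\}$ we have $$\sup\{\lambda_p^H(\Omega):\ \Omega\subset\mathbb R^2\text{ a bounded domain with }|\Omega|=1\}=\infty.$$
   Context: $\mathscr H$ is the set of functions $H:\mathbb R^2\to\mathbb R$ that are non-negative, convex and positively $1$-homogeneous ($H(tx)=tH(x)$ for $t>0$). $|\Omega|$ is the Lebesgue measure. For a bounded domain $\Omega\subset\mathbb R^2$, $$\lambda_p^H(\Omega):=\inf\Big\{\int_\Omega H^p(\nabla u)\,dx:\ u\in W_0^{1,p}(\Omega),\ \|u\|_{L^p(\Omega)}=1\Big\}.$$ *)

(* Defs.v *)
From mathcomp Require Import all_boot all_order all_algebra.
From mathcomp Require Import all_classical all_reals all_analysis.

Set Implicit Arguments.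
Unset Strict Implicit.
Unset Printing Implicit Defensive.

Import Order.TTheory GRing.Theory Num.Theory.
Import numFieldNormedType.Exports.

Local Open Scope classical_set_scope.
Local Open Scope ring_scope.

(* [lebesgue_measure] lives on [measurableTypeR R], which is convertible to [R]
   but carries another display; hence the type given here. *)
Definition leb2 {R : realType} :
    {measure set (measurableTypeR R * measurableTypeR R)%type -> \bar R} :=
  (@lebesgue_measure R \x @lebesgue_measure R)%E.

Section Sobolev.
Context {R : realType}.
Implicit Types (p : R) (Omega : set (R * R)) (H u phi : R * R -> R).
Implicit Types (g : R * R -> R * R).

Definition bounded_domain Omega :=
  [/\ open Omega, connected Omega, Omega !=set0 & bounded_set Omega].

Definition partial1 phi : R * R -> R := fun x => 'D_((1, 0) : R * R) phi x.
Definition partial2 phi : R * R -> R := fun x => 'D_((0, 1) : R * R) phi x.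
Definition grad phi : R * R -> R * R := fun x => (partial1 phi x, partial2 phi x).

(* The word [s] lists the successive differentiations: [true] stands for the
   first variable, [false] for the second one. *)
Definition iter_partial (s : seq bool) phi : R * R -> R :=
  foldr (fun b : bool => if b then partial1 else partial2) phi s.

Definition smooth phi := forall s : seq bool,
  [/\ continuous (iter_partial s phi),
      forall x, derivable (iter_partial s phi) x ((1, 0) : R * R) &
      forall x, derivable (iter_partial s phi) x ((0, 1) : R * R)].

Definition supp phi : set (R * R) := closure [set x | phi x != 0].

(* The space of smooth functions with compact support in [Omega], extended by
   [0] to the plane. *)
Definition test_function Omega phi :=
  [/\ smooth phi, compact (supp phi) & supp phi `<=` Omega].

Definition Lpnorm p Omega u : \bar R := Lnorm leb2 p%:E (EFin \o (u \_ Omega)).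

Definition in_Lp p Omega u : Prop := (u \_ Omega) \in Lfun leb2 p%:E.

(* To be used for [u], [fst \o g] and [snd \o g] in some [in_Lp p Omega], for
   which all the integrals below are those of integrable functions. *)
Definition weak_gradient Omega u g := forall phi, test_function Omega phi ->
  (\int[leb2]_(x in Omega) (u x * partial1 phi x))%R =
    - (\int[leb2]_(x in Omega) ((g x).1 * phi x))%R /\
  (\int[leb2]_(x in Omega) (u x * partial2 phi x))%R =
    - (\int[leb2]_(x in Omega) ((g x).2 * phi x))%R.

(* [u] belongs to the Sobolev space of exponent [p] on [Omega] and [g]
   represents its gradient, which is unique up to a null set. *)
Definition W1p p Omega u g :=
  [/\ in_Lp p Omega u, in_Lp p Omega (fst \o g), in_Lp p Omega (snd \o g) &
      weak_gradient Omega u g].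

Definition W1p_norm p Omega u g : \bar R :=
  (Lpnorm p Omega u + Lpnorm p Omega (fst \o g) + Lpnorm p Omega (snd \o g))%E.

(* Closure of the test functions in [W1p p Omega]. *)
Definition W01p p Omega u g := W1p p Omega u g /\
  forall e : R, 0 < e -> exists2 phi, test_function Omega phi &
    (W1p_norm p Omega (u \- phi)%R (g \- grad phi)%R < e%:E)%E.

Definition lambda p H Omega : \bar R :=
  ereal_inf [set y | exists u g,
    [/\ W01p p Omega u g, Lpnorm p Omega u = 1%E &
        y = (\int[leb2]_(x in Omega) (H (g x) `^ p)%:E)%E]].

Definition scrH : set (R * R -> R) :=
  [set H : R * R -> R | [/\ forall x : R * R, 0 <= H x,
               convex_function [set: R * R] H &
               forall (t : R) (x : R * R), 0 < t -> H (t *: x) = t * H x]].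

End Sobolev.

(* Main.v *)
(* A nonzero H in scrH dominates the positive part of a nonzero linear form
   l(x) = a x1 + b x2 (Hahn-Banach in the plane), so it suffices to bound the
   integral of (l(grad u))_+ ^ p from below.  Let q be a linear form with
   m <= q <= M on Omega and c := l(grad q) > 0.  For a test function phi,
   the divergence in direction (a, b) of

     phi_+ ^ p (q - M) + phi_- ^ p (q - m)

   integrates to 0; as q - M <= 0 <= q - m, only the positive part of
   D := l(grad phi) matters, and one gets
   int |phi|^p <= (2 p (M - m) / c)^p int D_+ ^ p.  This inequality passes to
   the closure of the test functions.  If, say, a <> 0, take q = a x1 and
   Omega = ]0, L[ x ]0, 1/L[: then M - m is of order L, and the bound on
   lambda blows up as L tends to 0. *)

Require Import Defs.
From mathcomp Require Import all_boot all_order all_algebra.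
From mathcomp Require Import all_classical all_reals all_analysis.
From mathcomp Require Import measurable_realfun.
From mathcomp Require Import ring lra.

Set Implicit Arguments.
Unset Strict Implicit.
Unset Printing Implicit Defensive.

Import Order.TTheory GRing.Theory Num.Theory.
Import numFieldNormedType.Exports.

Local Open Scope classical_set_scope.
Local Open Scope ring_scope.

(** * Integration in the plane *)

Section plane_integrals.
Context {R : realType}.
Local Notation RR := (measurableTypeR R * measurableTypeR R)%type.
Implicit Types f : R * R -> R.

(** Each point of an open set lies in a box with rational corners contained in the set, so the set
    is a countable union of such boxes. This links the topology of the plane to the product
    sigma-algebra. *)
Lemma open_measurable_plane (U : set (R * R)) :
  open U -> measurable (U : set RR).
Proof.
move=> oU.
pose box (q : rat * rat * (rat * rat)) : set RR :=
  `]ratr q.1.1, ratr q.1.2[%classic `*` `]ratr q.2.1, ratr q.2.2[%classic.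
have -> : U = \bigcup_(q in [set q | box q `<=` U]) box q.
  apply/seteqP; split=> [x Ux|x [q qU] /qU//].
  have /nbhs_ballP[e /= e0 eU] := open_nbhs_nbhs (conj oU Ux).
  have /rat_in_itvoo[a1 ha1] : x.1 - e < x.1 by lra.
  have /rat_in_itvoo[b1 hb1] : x.1 < x.1 + e by lra.
  have /rat_in_itvoo[a2 ha2] : x.2 - e < x.2 by lra.
  have /rat_in_itvoo[b2 hb2] : x.2 < x.2 + e by lra.
  move: ha1 hb1 ha2 hb2; rewrite !in_itv/=.
  move=> /andP[p1 p2] /andP[p3 p4] /andP[p5 p6] /andP[p7 p8].
  exists ((a1, b1), (a2, b2)) => /=.
    move=> [y1 y2]; rewrite /box/= !in_itv/= => -[/andP[q1 q2] /andP[q3 q4]].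
    apply: eU; split; rewrite /= /ball/= ltr_norml; apply/andP; split; lra.
  by rewrite /box/=; split=> /=; rewrite in_itv/=; apply/andP; split; lra.
rewrite bigcup_mkcond; apply: countable_bigcupT_measurable.
  exact: countableP.
by move=> q; case: ifP => // _; apply: measurableX; exact: measurable_itv.
Qed.

Lemma continuous_measurable_plane f :
  continuous f -> measurable_fun [set: RR] f.
Proof.
move=> /continuousP cf; apply: (measurability _ (RGenOpens.measurableE R)).
move=> _ [_ [a [b ->] <-]]; rewrite setTI; apply: open_measurable_plane.
exact/cf/interval_open.
Qed.

Lemma leb2_setX (A B : set (measurableTypeR R)) : measurable A -> measurable B ->
  leb2 (A `*` B) = (@lebesgue_measure R A * @lebesgue_measure R B)%E.
Proof. exact: product_measure1E. Qed.

Definition square (N : R) : set (R * R) := `[- N, N] `*` `[- N, N].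

Lemma measurable_square N : measurable (square N : set RR).
Proof. by apply: measurableX; exact: measurable_itv. Qed.

Lemma leb2_square_fin N : (leb2 (square N : set RR) < +oo)%E.
Proof.
rewrite leb2_setX; [|exact: measurable_itv..].
rewrite lebesgue_measure_itv /=.
by case: ifP => _; rewrite ?mule0 ?ltry// -EFinD -EFinM ltry.
Qed.

Lemma continuous_csupp_integrable N f : continuous f ->
  (forall z, ~ square N z -> f z = 0) ->
  leb2.-integrable [set: RR] (EFin \o f).
Proof.
move=> cf f0.
have -> : EFin \o f = (EFin \o f) \_ (square N : set RR).
  apply/funext => z; rewrite patchE /=; case: ifPn => //.
  by rewrite notin_setE => /f0 ->.
apply/integrable_restrict => //; first exact: measurable_square.
rewrite setTI; apply: measurable_bounded_integrable => /=.
- exact: measurable_square.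
- exact: leb2_square_fin.
- by apply: measurable_funTS; exact: continuous_measurable_plane.
- have : compact (f @` square N).
    apply: continuous_compact; first exact/continuous_subspaceT.
    by apply: compact_setX; exact: segment_compact.
  move=> /compact_bounded [M [Mr hM]]; exists M; split => // x Mx z Nz.
  by apply: (hM x Mx); exists z.
Qed.


Lemma integral_derive_csupp_eq0 (N : R) (h h1 : R -> R) : 0 < N -> continuous h1 ->
  (forall x : R, is_derive x 1 h (h1 x)) ->
  (forall x : R, ~ `[- N, N]%classic x -> h x = 0 /\ h1 x = 0) ->
  (\int[@lebesgue_measure R]_x (h1 x)%:E = 0)%E.
Proof.
(* [h0] does not cover the points [N] and [- N]. The fundamental theorem of calculus is therefore
   applied between [- M] and [M], where [h] is known to vanish. *)
move=> N0 ch1 dh h0; pose M := N + 1.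
have ch : continuous h.
  move=> x; apply: differentiable_continuous; apply/derivable1_diffP.
  by have [] := dh x.
have off x : M <= `|x| -> h x = 0 /\ h1 x = 0.
  move=> Mx; apply: h0; rewrite /= in_itv/= -ler_norml => xN.
  by move: Mx; rewrite /M; lra.
transitivity (\int[lebesgue_measure]_(x in `[(- M)%R, M]) (h1 x)%:E)%E.
  rewrite [RHS]integral_mkcond; apply: eq_integral => x _.
  rewrite patchE; case: ifPn => //; rewrite notin_setE/= in_itv/= -ler_norml.
  by move=> /negP; rewrite -ltNge => /ltW /off[_ ->].
rewrite (@continuous_FTC2 _ _ h).
- have [-> _] : h M = 0 /\ h1 M = 0 by apply: off; exact: ler_norm.
  have [-> _] : h (- M) = 0 /\ h1 (- M) = 0.
    by apply: off; rewrite normrN; exact: ler_norm.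
  by rewrite subee.
- by rewrite /M; lra.
- exact: continuous_subspaceT.
- split.
  + by move=> x _; have [] := dh x.
  + by apply: cvg_at_right_filter; exact: ch.
  + by apply: cvg_at_left_filter; exact: ch.
- by move=> x _; rewrite derive1E; have [_ ->] := dh x.
Qed.

(** Fubini with the first variable integrated innermost: on each horizontal line, the integrand is
    the derivative of a function with bounded support. *)
Lemma integral_partial1_csupp_eq0 (N : R) (F F1 : R * R -> R) : 0 < N ->
  continuous F1 ->
  (forall x y : R, is_derive x 1 (fun t => F (t, y)) (F1 (x, y))) ->
  (forall z, ~ square N z -> F z = 0 /\ F1 z = 0) ->
  (\int[@leb2 R]_z (F1 z)%:E = 0)%E.
Proof.
move=> N0 cF1 dF F0.
have iF1 : leb2.-integrable [set: RR] (EFin \o F1).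
  by apply: (@continuous_csupp_integrable N) => // z /F0[].
rewrite /leb2 -(integral21_prod_meas1 iF1)/=.
rewrite (eq_integral (cst 0%E)) ?integral0// => y _ /=.
apply: (@integral_derive_csupp_eq0 N (fun x => F (x, y)) (fun x => F1 (x, y))).
- by [].
- move=> x; apply: (@cvg_comp _ _ _ (fun t => (t, y)) F1 _ (nbhs (x, y))).
    exact: (@cvg_pair _ _ _ _ (nbhs x) (nbhs y) _ _ _ _ _ cvg_id (cvg_cst y)).
  exact: cF1.
- by move=> x xN; apply: F0 => -[].
Qed.

Lemma integral_partial2_csupp_eq0 (N : R) (F F2 : R * R -> R) : 0 < N ->
  continuous F2 ->
  (forall x y : R, is_derive y 1 (fun t => F (x, t)) (F2 (x, y))) ->
  (forall z, ~ square N z -> F z = 0 /\ F2 z = 0) ->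
  (\int[@leb2 R]_z (F2 z)%:E = 0)%E.
Proof.
move=> N0 cF2 dF F0.
have iF2 : leb2.-integrable [set: RR] (EFin \o F2).
  by apply: (@continuous_csupp_integrable N) => // z /F0[].
rewrite /leb2 -(integral12_prod_meas1 iF2)/=.
rewrite (eq_integral (cst 0%E)) ?integral0// => x _ /=.
apply: (@integral_derive_csupp_eq0 N (fun y => F (x, y)) (fun y => F2 (x, y))).
- by [].
- move=> y; apply: (@cvg_comp _ _ _ (fun t => (x, t)) F2 _ (nbhs (x, y))).
    exact: (@cvg_pair _ _ _ _ (nbhs x) (nbhs y) _ _ _ _ _ (cvg_cst x) cvg_id).
  exact: cF2.
- by move=> y yN; apply: F0 => -[].
Qed.

End plane_integrals.

(** * Powers of the positive part *)

Section positive_part_power.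
Context {R : realType}.
Implicit Types (p r t : R).

Definition ppow p t := Num.max t 0 `^ p.

Lemma ppow_ge0 p t : 0 <= ppow p t.
Proof. exact: powR_ge0. Qed.

Lemma ppow_pos p t : 0 <= t -> ppow p t = t `^ p.
Proof. by move=> t0; rewrite /ppow max_l. Qed.

Lemma ppow_neg p t : 0 < p -> t <= 0 -> ppow p t = 0.
Proof. by move=> p0 t0; rewrite /ppow max_r// powR0// gt_eqF. Qed.

Lemma ppow_addN p t : 0 < p -> ppow p t + ppow p (- t) = `|t| `^ p.
Proof.
move=> p0; have [t0|t0] := leP 0 t.
  by rewrite ppow_pos// (@ppow_neg _ (- t)) ?addr0 ?oppr_le0// ger0_norm.
by rewrite (@ppow_neg _ t) ?ltW// add0r ppow_pos ?oppr_ge0 ?ltW// ltr0_norm.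
Qed.

Lemma le_ppow r x y : 0 <= r -> x <= y -> ppow r x <= ppow r y.
Proof.
move=> r0 xy; have m0 z : 0 <= Num.max z 0 :> R by rewrite le_max lexx orbT.
apply: ge0_ler_powR; rewrite ?nnegrE//.
by rewrite ge_max !le_max xy lexx orbT.
Qed.

Lemma is_derive_cvg (f : R -> R) (x df : R) :
  h^-1 * (f (h + x) - f x) @[h --> 0^'] --> df -> is_derive x 1 f df.
Proof.
move=> cf.
have cf' : h^-1 *: ((f \o shift x) (h *: (1 : R)) - f x) @[h --> 0^'] --> df.
  by under eq_fun do rewrite /= [_ *: 1]mulr1.
by split; [exact: cvgP cf'|exact: cvg_lim cf'].
Qed.

Lemma continuous_ppow r : 0 < r -> continuous (ppow r).
Proof.
move=> r0 t; have [t0|t0|->] := ltgtP t 0.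
- rewrite /continuous_at (ppow_neg r0 (ltW t0)).
  apply: cvg_near_cst; near=> s; rewrite ppow_neg//.
  by apply: ltW; near: s; exact: lt_nbhsl.
- have : {for t, continuous (fun s : R => s `^ r)}.
    apply: differentiable_continuous; apply/derivable1_diffP.
    by apply: derivable_powR; rewrite in_itv/= t0.
  rewrite /continuous_at (ppow_pos _ (ltW t0)); apply: cvg_trans.
  apply: near_eq_cvg; near=> s; rewrite ppow_pos//.
  by apply: ltW; near: s; exact: lt_nbhsr.
- rewrite /continuous_at (ppow_neg r0 (lexx _)); apply/cvgrPdist_lt => e e0.
  near=> s; rewrite sub0r normrN ger0_norm ?ppow_ge0//.
  have [s0|s0] := leP s 0; first by rewrite ppow_neg.
  rewrite ppow_pos ?ltW//.
  (* For positive [s], the bound [s < e ^ (1/r)] is what makes [s ^ r] smaller than [e]. *)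
  have -> : e = (e `^ r^-1) `^ r.
    by rewrite -powRrM mulVf ?gt_eqF// powRr1// ltW.
  apply: gt0_ltr_powR; rewrite ?nnegrE ?powR_ge0 ?ltW//.
  by near: s; apply: lt_nbhsl; exact: powR_gt0.
Unshelve. all: by end_near. Qed.

(** Only [t = 0] is delicate: there the difference quotient at [h] is exactly [ppow (p - 1) h],
    which tends to 0 because [p > 1]. Hence powers of the positive part of a smooth function can be
    differentiated across its zeros. *)
Lemma is_derive_ppow p t : 1 < p -> is_derive t 1 (ppow p) (p * ppow (p - 1) t).
Proof.
move=> p1; have p0 : 0 < p by lra.
have p10 : 0 < p - 1 by lra.
have [t0|t0|->] := ltgtP t 0.
- rewrite (ppow_neg p10 (ltW t0)) mulr0.
  apply: (@near_eq_is_derive _ _ _ (cst 0)) => //.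
  near=> s; rewrite ppow_neg//.
  by apply: ltW; near: s; exact: lt_nbhsl.
- rewrite (ppow_pos _ (ltW t0)).
  apply: (@near_eq_is_derive _ _ _ (fun s : R => s `^ p)) => //.
    near=> s; rewrite ppow_pos//.
    by apply: ltW; near: s; exact: lt_nbhsr.
  exact: is_derive1_powR.
- rewrite (ppow_neg p10 (lexx _)) mulr0; apply: is_derive_cvg.
  apply: (@cvg_trans _ (ppow (p - 1) h @[h --> 0^'])).
    apply: near_eq_cvg; near=> h.
    have h0 : h != 0 by near: h; exact: nbhs_dnbhs_neq.
    rewrite addr0 (ppow_neg p0 (lexx _)) subr0.
    have [hn|hp] := leP h 0; first by rewrite !ppow_neg ?mulr0.
    by rewrite !ppow_pos ?ltW// -(mulr_powRB1 (ltW hp) p0) mulKf.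
  have := @continuous_ppow _ p10 0; rewrite /continuous_at (ppow_neg p10 (lexx _)).
  by apply: cvg_trans; apply: cvg_app; exact: nbhs_dnbhs.
Unshelve. all: by end_near. Qed.

End positive_part_power.

(** * A one-sided Poincare inequality for test functions *)

Section test_functions.
Context {R : realType}.
Implicit Types (phi : R * R -> R).

(** The complement of the support is open, so [phi] vanishes on a neighbourhood of [z] and its
    derivatives vanish too. *)
Lemma not_supp_eq0 phi z : ~ supp phi z ->
  [/\ phi z = 0, partial1 phi z = 0 & partial2 phi z = 0].
Proof.
move=> zS; have near0 : \near z, phi z = 0.
  have /open_nbhs_nbhs : open_nbhs z (~` supp phi).
    by split => //; apply: closed_openC; exact: closed_closure.
  apply: filterS => w; apply: contra_notP => /eqP w0.
  exact: subset_closure.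
have D0 v : v != 0 -> 'D_v phi z = 0.
  by move=> v0; rewrite (near_eq_derive v (g := cst 0) near0) derive_cst.
split; first exact: nbhs_singleton near0.
- by apply: D0; rewrite xpair_eqE oner_eq0.
- by apply: D0; rewrite xpair_eqE oner_eq0 andbF.
Qed.

Lemma compact_sub_square (K : set (R * R)) : compact K ->
  exists2 N : R, 0 < N & K `<=` square N.
Proof.
move=> /compact_bounded[N [_ KN]]; exists (`|N| + 1).
  by rewrite ltr_wpDl.
have N1 : N < `|N| + 1 by have := ler_norm N; lra.
move=> z /(KN _ N1); rewrite /= prod_normE ge_max => /andP[z1 z2].
by split; rewrite /= in_itv/= -ler_norml.
Qed.

Lemma is_derive_partial1 phi (x y : R) : smooth phi ->
  is_derive x 1 (fun t => phi (t, y)) (partial1 phi (x, y)).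
Proof.
move=> /(_ [::])[_ /(_ (x, y)) /= d1 _]; apply: is_derive_cvg.
move: d1; rewrite /derivable/partial1 /derive.
suff -> : (fun h : R => h^-1 *: ((phi \o shift (x, y)) (h *: (1, 0)) - phi (x, y)))
  = (fun h => h^-1 * (phi (h + x, y) - phi (x, y))) by [].
apply/funext => h; rewrite /= /GRing.scale/=; congr (_ * (phi _ - _)).
by apply: injective_projections; rewrite /= /GRing.scale/= ?mulr1 ?mulr0 ?add0r.
Qed.

Lemma is_derive_partial2 phi (x y : R) : smooth phi ->
  is_derive y 1 (fun t => phi (x, t)) (partial2 phi (x, y)).
Proof.
move=> /(_ [::])[_ _ /(_ (x, y)) /= d1]; apply: is_derive_cvg.
move: d1; rewrite /derivable/partial2 /derive.
suff -> : (fun h : R => h^-1 *: ((phi \o shift (x, y)) (h *: (0, 1)) - phi (x, y)))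
  = (fun h => h^-1 * (phi (x, h + y) - phi (x, y))) by [].
apply/funext => h; rewrite /= /GRing.scale/=; congr (_ * (phi _ - _)).
by apply: injective_projections; rewrite /= /GRing.scale/= ?mulr1 ?mulr0 ?add0r.
Qed.

Lemma is_derive_affine (k c x : R) : is_derive x 1 (fun t : R => k * t + c) k.
Proof.
apply: is_derive_cvg; apply: cvg_near_cst; near=> h.
by field; near: h; exact: nbhs_dnbhs_neq.
Unshelve. all: by end_near. Qed.

(** A Young inequality with crude constants: the product is at most the [p]-th power of the larger
    of [y] and [s]. *)
Lemma powRB1M_le (p y s : R) : 1 < p -> 0 <= y -> 0 <= s ->
  y `^ (p - 1) * s <= y `^ p + s `^ p.
Proof.
move=> p1 y0 s0; have p0 : 0 < p by lra.
have p10 : 0 <= p - 1 by lra.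
have [sy|/ltW ys] := leP s y.
  rewrite -(mulr_powRB1 y0 p0) mulrC; apply: (@le_trans _ _ (y * y `^ (p - 1))).
    by rewrite ler_wpM2r ?powR_ge0.
  by rewrite lerDl powR_ge0.
rewrite -(mulr_powRB1 s0 p0) mulrC; apply: (@le_trans _ _ (s * s `^ (p - 1))).
  by rewrite ler_wpM2l// ge0_ler_powR.
by rewrite lerDr powR_ge0.
Qed.

(** * The flux and its directional derivatives *)

Section flux.
Variables (p al be m M : R) (phi : R * R -> R).
Hypotheses (p1 : 1 < p) (sphi : smooth phi).

Let q (z : R * R) := al * z.1 + be * z.2.

(** The positive part of [phi] is paired with [q - M] and the negative part with [q - m], so that
    after differentiation the derivative of [phi] has a nonpositive coefficient wherever
    [m <= q <= M], whatever the sign of [phi]. *)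
Definition flux z := ppow p (phi z) * (q z - M) + ppow p (- phi z) * (q z - m).

(* The derivative of [flux] in a direction along which [phi] has derivative [d]
   and [q] has derivative [c]. *)
Definition dflux (c : R) (d : R * R -> R) z :=
  p * d z * (ppow (p - 1) (phi z) * (q z - M) -
             ppow (p - 1) (- phi z) * (q z - m)) + c * `|phi z| `^ p.

Let p0 : 0 < p. Proof. exact: lt_trans ltr01 p1. Qed.

Lemma is_derive_flux1D (f g : R -> R) (x f' c : R) :
  is_derive x 1 f f' -> is_derive x 1 g c ->
  is_derive x 1
    (fun t => ppow p (f t) * (g t - M) + ppow p (- f t) * (g t - m))
    (p * f' * (ppow (p - 1) (f x) * (g x - M) -
               ppow (p - 1) (- f x) * (g x - m)) + c * `|f x| `^ p).
Proof.
move=> df dg.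
have d1 : is_derive x 1 (fun t => ppow p (f t)) (f' * (p * ppow (p - 1) (f x))).
  have dp := is_derive_ppow (f x) p1.
  by rewrite mulrC; exact: is_derive1_comp.
have d2 : is_derive x 1 (fun t => ppow p (- f t))
    (- f' * (p * ppow (p - 1) (- f x))).
  have dp := is_derive_ppow (- f x) p1.
  by rewrite mulrC; apply: (@is_derive1_comp _ (ppow p) (fun t => - f t)).
have d3 k : is_derive x 1 (fun t => g t - k) c.
  by apply: is_derive_eq; rewrite subr0.
apply: is_derive_eq.
(* Differentiating [g] yields [c] times the sum of the powers of the positive and negative parts,
   which is the power of the absolute value. *)
rewrite -(ppow_addN _ p0) /GRing.scale/=; ring.
Qed.

Lemma dflux_eq0 c d z : phi z = 0 -> dflux c d z = 0.
Proof.
move=> z0; rewrite /dflux z0 normr0 oppr0 powR0 ?gt_eqF//.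
by rewrite ppow_neg ?subr_gt0// !mul0r subrr !mulr0 addr0.
Qed.

Lemma flux_eq0 z : phi z = 0 -> flux z = 0.
Proof. by move=> z0; rewrite /flux z0 oppr0 ppow_neg// !mul0r addr0. Qed.

Lemma continuous_smooth : continuous phi.
Proof. by have [] := sphi [::]. Qed.

Lemma continuous_partial1 : continuous (partial1 phi).
Proof. by have [] := sphi [:: true]. Qed.

Lemma continuous_partial2 : continuous (partial2 phi).
Proof. by have [] := sphi [:: false]. Qed.

Lemma continuous_norm_powR : continuous (fun z => `|phi z| `^ p).
Proof.
have -> : (fun z => `|phi z| `^ p) = (fun z => ppow p (phi z) + ppow p (- phi z)).
  by apply/funext => z; rewrite ppow_addN.
move=> z; apply: cvgD.
  by apply: (@cvg_comp _ _ _ phi (ppow p)); [exact: continuous_smooth|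
    exact: continuous_ppow].
apply: (@cvg_comp _ _ _ (fun z => - phi z) (ppow p)); last exact: continuous_ppow.
by apply: cvgN; exact: continuous_smooth.
Qed.

Lemma continuous_dflux c d : continuous d -> continuous (dflux c d).
Proof.
have p10 : 0 < p - 1 by rewrite subr_gt0.
move=> cd z; apply: cvgD; last first.
  by apply: cvgM; [exact: cvg_cst|exact: continuous_norm_powR].
have cq k : q w - k @[w --> z] --> q z - k.
  apply: cvgB; last exact: cvg_cst.
  by apply: cvgD; apply: cvgM; [exact: cvg_cst|exact: cvg_fst|exact: cvg_cst|
    exact: cvg_snd].
apply: cvgM; first by apply: cvgM; [exact: cvg_cst|exact: cd].
apply: cvgB; apply: cvgM => //.
  by apply: (@cvg_comp _ _ _ phi (ppow (p - 1))); [exact: continuous_smooth|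
    exact: continuous_ppow].
apply: (@cvg_comp _ _ _ (fun z => - phi z) (ppow (p - 1))).
  by apply: cvgN; exact: continuous_smooth.
exact: continuous_ppow.
Qed.

Variable N : R.
Hypotheses (N0 : 0 < N) (phi0 : forall z, ~ square N z -> phi z = 0).

Lemma integrable_dflux c d : continuous d ->
  leb2.-integrable setT (EFin \o dflux c d).
Proof.
move=> cd; apply: (@continuous_csupp_integrable _ N).
  exact: continuous_dflux.
by move=> z /phi0; exact: dflux_eq0.
Qed.

Lemma integral_dflux1 : (\int[leb2]_z (dflux al (partial1 phi) z)%:E = 0)%E.
Proof.
apply: (@integral_partial1_csupp_eq0 _ N flux) => //.
- by apply: continuous_dflux; exact: continuous_partial1.
- move=> x y; apply: is_derive_flux1D; first exact: is_derive_partial1.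
  exact: (is_derive_affine al (be * y) x).
- by move=> z /phi0 z0; rewrite flux_eq0// dflux_eq0.
Qed.

Lemma integral_dflux2 : (\int[leb2]_z (dflux be (partial2 phi) z)%:E = 0)%E.
Proof.
apply: (@integral_partial2_csupp_eq0 _ N flux) => //.
- by apply: continuous_dflux; exact: continuous_partial2.
- move=> x y; apply: is_derive_flux1D; first exact: is_derive_partial2.
  have -> : (fun t => q (x, t)) = (fun t => be * t + al * x).
    by apply/funext => t; rewrite /q/= addrC.
  exact: is_derive_affine.
- by move=> z /phi0 z0; rewrite flux_eq0// dflux_eq0.
Qed.

(** [dflux] is linear in the pair [(c, d)]. The derivative of the flux along [(a, b)] thus has the
    same shape, with the derivatives of [q] and [phi] along [(a, b)]. *)
Lemma dflux_lin a b z : a * dflux al (partial1 phi) z + b * dflux be (partial2 phi) z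
  = dflux (a * al + b * be) (fun z => a * partial1 phi z + b * partial2 phi z) z.
Proof. by rewrite /dflux; ring. Qed.

(** The pointwise form of the Poincare inequality. The term of [dflux] containing [d] is at least
    [- p (M - m) e |phi|^(p-1)], where [e] is the positive part of [d]; [s] is scaled so that this
    equals [- (c/2) |phi|^(p-1) s]. By [powRB1M_le], half of [c |phi|^p] then absorbs it up to
    [(c/2) s^p]. *)
Lemma dflux_lower c (d : R * R -> R) z : 0 < c -> m <= q z <= M ->
  c / 2 * `|phi z| `^ p <=
    dflux c d z + c / 2 * (2 * p * (M - m) / c) `^ p * ppow p (d z).
Proof.
move=> c0 /andP[mq qM]; set y := `|phi z|; set e := Num.max (d z) 0.
have e0 : 0 <= e by rewrite le_max lexx orbT.
have de : d z <= e by rewrite le_max lexx.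
have mM : 0 <= M - m by lra.
pose s := 2 * p * (M - m) / c * e.
have k0 : 0 <= 2 * p * (M - m) / c.
  by rewrite divr_ge0 ?mulr_ge0 ?(ltW c0) ?(ltW p0).
have s0 : 0 <= s by rewrite mulr_ge0.
have mix := powRB1M_le p1 (normr_ge0 (phi z)) s0.
have -> : c / 2 * (2 * p * (M - m) / c) `^ p * ppow p (d z) = c / 2 * s `^ p.
  by rewrite /s [in RHS]powRM// mulrA.
(* [d <= e] and [q - M <= 0 <= q - m]: only one of the two terms is nonzero,
   depending on the sign of [phi z]. *)
have main : - (p * (M - m) * e * y `^ (p - 1)) <= p * d z *
    (ppow (p - 1) (phi z) * (q z - M) - ppow (p - 1) (- phi z) * (q z - m)).
  rewrite -subr_ge0 opprK.
  have p10 : 0 < p - 1 by rewrite subr_gt0.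
  rewrite /y; have [x0|/ltW x0] := leP 0 (phi z).
    rewrite ger0_norm// (@ppow_neg _ _ (- phi z)) ?oppr_le0// ppow_pos// mul0r subr0.
    (* Splitting [M - m] into [(M - q) + (q - m)] displays the difference as a sum of products of
       nonnegative factors. *)
    have -> : p * d z * (phi z `^ (p - 1) * (q z - M)) +
        p * (M - m) * e * phi z `^ (p - 1) =
      p * phi z `^ (p - 1) * ((M - q z) * (e - d z) + (q z - m) * e) by ring.
    apply: mulr_ge0; first by rewrite mulr_ge0 ?powR_ge0// ltW.
    by apply: addr_ge0; apply: mulr_ge0 => //; lra.
  rewrite ler0_norm// (@ppow_neg _ _ (phi z))// ppow_pos ?oppr_ge0// mul0r sub0r.
  have -> : p * d z * - ((- phi z) `^ (p - 1) * (q z - m)) +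
      p * (M - m) * e * (- phi z) `^ (p - 1) =
    p * (- phi z) `^ (p - 1) * ((q z - m) * (e - d z) + (M - q z) * e) by ring.
  apply: mulr_ge0; first by rewrite mulr_ge0 ?powR_ge0// ltW.
  by apply: addr_ge0; apply: mulr_ge0 => //; lra.
have es : p * (M - m) * e * y `^ (p - 1) = c / 2 * (y `^ (p - 1) * s).
  by rewrite /s; field; rewrite gt_eqF.
have c20 : 0 <= c / 2 by lra.
have := ler_wpM2l c20 mix; rewrite -es /dflux -/y; lra.
Qed.

End flux.

Lemma poincare (p a b al be m M : R) (Omega : set (R * R)) phi :
  1 < p -> 0 < a * al + b * be ->
  (forall z, Omega z -> m <= al * z.1 + be * z.2 <= M) ->
  test_function Omega phi ->
  (\int[leb2]_z (`|phi z| `^ p)%:E <=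
   ((2 * p * (M - m) / (a * al + b * be)) `^ p)%:E *
   \int[leb2]_z (ppow p (a * partial1 phi z + b * partial2 phi z))%:E)%E.
Proof.
move=> p1 c0 qmM [sphi cphi sO]; have p0 : 0 < p by exact: lt_trans ltr01 p1.
have [N N0 sN] := compact_sub_square cphi.
have phi0 z : ~ square N z -> phi z = 0.
  by move=> zN; have [] := @not_supp_eq0 phi z (fun h => zN (sN _ h)).
set c := a * al + b * be in c0 *; set K := (_ `^ p).
pose d z := a * partial1 phi z + b * partial2 phi z.
have cd : continuous d.
  move=> z; apply: cvgD; apply: cvgM; [exact: cvg_cst|exact: continuous_partial1|
    exact: cvg_cst|exact: continuous_partial2].
pose I := dflux p al be m M phi c d.
have iI : leb2.-integrable setT (EFin \o I) by apply: (integrable_dflux _ _ _ _ p1 sphi phi0).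
have I0 : (\int[leb2]_z (I z)%:E = 0)%E.
  have c1 := continuous_partial1 sphi; have c2 := continuous_partial2 sphi.
  transitivity (\int[leb2]_z (a%:E * (dflux p al be m M phi al (partial1 phi) z)%:E
    + b%:E * (dflux p al be m M phi be (partial2 phi) z)%:E))%E.
    by apply: eq_integral => z _; rewrite -!EFinM -EFinD dflux_lin.
  rewrite integralD//.
  - rewrite !integralZl//; try exact: (integrable_dflux _ _ _ _ p1 sphi phi0).
    by rewrite (integral_dflux1 _ _ _ _ p1 sphi N0 phi0)
      (integral_dflux2 _ _ _ _ p1 sphi N0 phi0) !mule0 adde0.
  - by apply: integrableZl => //; exact: (integrable_dflux _ _ _ _ p1 sphi phi0).
  - by apply: integrableZl => //; exact: (integrable_dflux _ _ _ _ p1 sphi phi0).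
have iP : leb2.-integrable setT (EFin \o (fun z => ppow p (d z))).
  apply: (@continuous_csupp_integrable _ N).
    move=> z; apply: (@cvg_comp _ _ _ d (ppow p)); first exact: cd.
    exact: continuous_ppow.
  move=> z zN; have [_ d1 d2] := @not_supp_eq0 phi z (fun h => zN (sN _ h)).
  by rewrite /d d1 d2 !mulr0 addr0 ppow_neg.
have iphi : leb2.-integrable setT (EFin \o (fun z => `|phi z| `^ p)).
  apply: (@continuous_csupp_integrable _ N); first exact: continuous_norm_powR.
  by move=> z /phi0 ->; rewrite normr0 powR0// gt_eqF.
(* This is [dflux_lower] multiplied by [2 / c]; the term in [I] then disappears, its integral being
   0. *)
have step : (\int[leb2]_z (`|phi z| `^ p)%:E <=
    \int[leb2]_z ((2 / c)%:E * (I z)%:E + K%:E * (ppow p (d z))%:E))%E.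
  apply: le_integral => //.
    by apply: integrableD => //; apply: integrableZl.
  move=> z _; rewrite -!EFinM -EFinD lee_fin.
  have [zO|zO] := pselect (Omega z).
    have := dflux_lower phi p1 d c0 (qmM z zO); rewrite -/(I z) -/K => le1.
    have c20 : 0 <= 2 / c by rewrite divr_ge0// ltW.
    have := ler_wpM2l c20 le1.
    have -> : 2 / c * (c / 2 * `|phi z| `^ p) = `|phi z| `^ p.
      by field; rewrite gt_eqF.
    move=> /le_trans; apply; rewrite le_eqVlt; apply/orP; left; apply/eqP.
    by field; rewrite gt_eqF.
  (* Outside [Omega] there is no control on [q], but [phi] and hence [I] vanish. *)
  have [z0 _ _] := @not_supp_eq0 phi z (fun h => zO (sO _ h)).
  rewrite z0 normr0 powR0 ?gt_eqF// /I dflux_eq0// mulr0 add0r.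
  by rewrite mulr_ge0 ?powR_ge0.
apply: (le_trans step).
rewrite integralD//; [|by apply: integrableZl..].
by rewrite !integralZl// I0 mule0 add0e.
Qed.

End test_functions.

(** * Linear minorants of sublinear functions *)

Section sublinear_minorant.
Context {R : realType}.
Variable H : R * R -> R.
Hypothesis hH : scrH H.

Let H_ge0 z : 0 <= H z. Proof. by have [] := hH. Qed.

Let HZ (t : R) z : 0 < t -> H (t *: z) = t * H z.
Proof. by have [_ _] := hH; exact. Qed.

Lemma scrH0 : H 0 = 0.
Proof. by have := @HZ 2 0; rewrite scaler0 => /(_ (ltr0n R 2)); lra. Qed.

(** Convexity at the midpoint of [x] and [y], rescaled by homogeneity. *)
Lemma scrHD x y : H (x + y) <= H x + H y.
Proof.
have [_ cH _] := hH.
have h0 : 0 <= 2^-1 :> R by rewrite invr_ge0.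
have h1 : 2^-1 <= 1 :> R by lra.
have := cH (Itv01 h0 h1) x y (mem_setT _) (mem_setT _).
have -> : conv (Itv01 h0 h1) (x : convex_lmodType (R * R)%type) y = 2^-1 *: (x + y).
  transitivity (2^-1 *: x + (1 - 2^-1) *: y) => //.
  by rewrite scalerDr; congr (_ + _ *: _); lra.
have -> : conv (Itv01 h0 h1) (H x : R^o) (H y) = 2^-1 * H x + (1 - 2^-1) * H y by [].
by rewrite HZ ?invr_gt0//; lra.
Qed.

(** One extension step of Hahn-Banach. On the line of [v], the form [t * H v] is below [H]: by
    homogeneity for [t > 0], and by nonnegativity of [H] for the other [t]. It remains to choose the
    value [al] at [w]. *)
Lemma scrH_minorant_basis v w : 0 < H v ->
  exists al : R, forall t s : R, t * H v + s * al <= H (t *: v + s *: w).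
Proof.
move=> Hv.
have lin t : t * H v <= H (t *: v).
  have [t0|t0] := ltP 0 t; first by rewrite HZ.
  by rewrite (le_trans _ (H_ge0 _))// mulr_le0_ge0// ltW.
(* Domination for [s = 1] requires [al] to be a lower bound of [S]; for [s = -1] it requires [al] to
   exceed the lower bounds given by [lbS]. Subadditivity makes both compatible, and [inf S]
   satisfies them. *)
pose S := [set H (w + t *: v) - t * H v | t in [set: R]].
have lbS s : lbound S (s * H v - H (- w + s *: v)).
  move=> _ [t _ <-]; have := scrHD (w + t *: v) (- w + s *: v).
  rewrite addrACA subrr add0r -scalerDl => hts.
  by have := lin (t + s); lra.
have hlS : has_lbound S by exists (0 * H v - H (- w + 0 *: v)).
exists (inf S) => t s.
(* Dividing by the absolute value of [s] reduces the general case to [s = 1] and [s = -1]. *)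
have [s0|s0|->] := ltgtP s 0; last by rewrite mul0r addr0 scale0r addr0.
- have r0 : 0 < - s by lra.
  have : (t / - s) * H v - H (- w + (t / - s) *: v) <= inf S.
    by apply: lb_le_inf => //; exists (H (w + 0 *: v) - 0 * H v), 0.
  move=> /(ler_wpM2l (ltW r0)); rewrite mulrBr mulrA -(HZ _ r0).
  have -> : - s * (t / - s) = t by field; lra.
  have -> : - s *: (- w + (t / - s) *: v) = t *: v + s *: w.
    rewrite scalerDr scalerN scaleNr opprK addrC scalerA; congr (_ *: _ + _).
    by field; lra.
  lra.
- have : inf S <= H (w + (t / s) *: v) - (t / s) * H v.
    by apply: ge_inf => //; exists (t / s).
  move=> /(ler_wpM2l (ltW s0)); rewrite mulrBr mulrA -(HZ _ s0).
  have -> : s * (t / s) = t by field; lra.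
  have -> : s *: (w + (t / s) *: v) = t *: v + s *: w.
    rewrite scalerDr addrC scalerA; congr (_ *: _ + _).
    by field; lra.
  lra.
Qed.

Lemma scrH_minorant : H != cst 0 ->
  exists a b : R, (a != 0) || (b != 0) /\ forall z, a * z.1 + b * z.2 <= H z.
Proof.
move=> Hn0.
(* Here [i] selects a coordinate axis and [e] a sign, so the vector is one of the four unit vectors
   on the axes. If [H] vanished at all four, it would vanish on both axes, hence everywhere by
   subadditivity. *)
have axis : exists i e : R, [/\ e = 1 \/ e = -1, i = 0 \/ i = 1 &
    0 < H (e * (1 - i), e * i)].
  apply: contrapT => noaxis; move/eqP: Hn0; apply; apply/funext => z /=.
  have ax0 i e : e = 1 \/ e = -1 -> i = 0 \/ i = 1 -> H (e * (1 - i), e * i) = 0.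
    move=> he hi; apply/eqP; rewrite eq_le H_ge0 andbT leNgt.
    by apply/negP => Hp; apply: noaxis; exists i, e.
  have axt i (t : R) : i = 0 \/ i = 1 -> H (t * (1 - i), t * i) = 0.
    move=> hi; have [t0|t0|->] := ltgtP t 0.
    - have -> : (t * (1 - i), t * i) = (- t) *: (- 1 * (1 - i), - 1 * i) :> R * R.
        by apply: injective_projections; rewrite /= /GRing.scale/=; ring.
      by rewrite HZ ?oppr_gt0// ax0 ?mulr0//; right.
    - have -> : (t * (1 - i), t * i) = t *: (1 * (1 - i), 1 * i) :> R * R.
        by apply: injective_projections; rewrite /= /GRing.scale/=; ring.
      by rewrite HZ// ax0 ?mulr0//; left.
    - by rewrite !mul0r -[RHS]scrH0.
  apply/eqP; rewrite eq_le H_ge0 andbT.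
  have -> : z = (z.1 * (1 - 0), z.1 * 0) + (z.2 * (1 - 1), z.2 * 1) :> R * R.
    by apply: injective_projections; rewrite /=; ring.
  apply: (le_trans (scrHD _ _)).
  by rewrite !axt ?addr0//; [right|left].
have [i [e [he hi Hv]]] := axis.
(* [(i, 1 - i)] is the unit vector of the other axis. *)
have [al hal] := scrH_minorant_basis (i, 1 - i) Hv.
have ee : e * e = 1 by case: he => ->; ring.
set h := H _ in Hv hal.
(* These are the coefficients, in standard coordinates, of the form with value [h] at the chosen
   unit vector and [al] at the other one; the coefficient on the chosen axis is [e * h], which is
   nonzero. *)
exists (e * (1 - i) * h + i * al), (e * i * h + (1 - i) * al); split.
  have e0 : e != 0 by case: he => ->; rewrite ?oppr_eq0 oner_eq0.
  case: hi => ->.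
    by rewrite subr0 mulr1 mul0r addr0 mulf_neq0// gt_eqF.
  by rewrite subrr mulr1 mul0r addr0 (mulf_neq0 e0) ?orbT// gt_eqF.
move=> z.
have := hal (e * (1 - i) * z.1 + e * i * z.2) (i * z.1 + (1 - i) * z.2).
have -> : (e * (1 - i) * z.1 + e * i * z.2) *: (e * (1 - i), e * i) +
    (i * z.1 + (1 - i) * z.2) *: (i, 1 - i) = z.
  apply: injective_projections; rewrite /= /GRing.scale/=.
    have -> : (e * (1 - i) * z.1 + e * i * z.2) * (e * (1 - i)) +
      (i * z.1 + (1 - i) * z.2) * i =
      e * e * ((1 - i) * z.1 + i * z.2) * (1 - i) + (i * z.1 + (1 - i) * z.2) * i by ring.
    by rewrite ee; case: hi => ->; ring.
  have -> : (e * (1 - i) * z.1 + e * i * z.2) * (e * i) +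
      (i * z.1 + (1 - i) * z.2) * (1 - i) =
      e * e * ((1 - i) * z.1 + i * z.2) * i + (i * z.1 + (1 - i) * z.2) * (1 - i) by ring.
  by rewrite ee; case: hi => ->; ring.
by apply: le_trans; rewrite le_eqVlt; apply/orP; left; apply/eqP; ring.
Qed.

End sublinear_minorant.

(** * Rectangles *)

Section rectangle.
Context {R : realType}.
Variables l1 l2 : R.
Hypotheses (l10 : 0 < l1) (l20 : 0 < l2).

Definition rectangle : set (R * R) := `]0, l1[ `*` `]0, l2[.

Lemma leb2_rectangle : leb2 rectangle = (l1 * l2)%:E.
Proof.
rewrite /rectangle leb2_setX; [|exact: measurable_itv..].
by rewrite !lebesgue_measure_itv/= !lte_fin l10 l20 !oppr0 !adde0 -EFinM.
Qed.

Lemma open_rectangle : open rectangle.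
Proof.
have -> : rectangle = fst @^-1` `]0, l1[ `&` snd @^-1` `]0, l2[ by [].
apply: openI; apply: open_comp; try exact: interval_open.
  by move=> z _; exact: cvg_fst.
by move=> z _; exact: cvg_snd.
Qed.

(** The rectangle is a union of crosses, each made of one horizontal slice and the vertical slice
    through the middle; all of them contain the centre. *)
Lemma connected_rectangle : connected rectangle.
Proof.
have slice1 (y : R) : connected ((fun t : R => (t, y)) @` `]0, l1[).
  apply: connected_continuous_connected; first exact/connected_intervalP/interval_is_interval.
  apply: continuous_subspaceT => x.
  exact: (@cvg_pair _ _ _ _ (nbhs x) (nbhs y) _ _ _ _ _ cvg_id (cvg_cst y)).
have slice2 (x : R) : connected ((fun t : R => (x, t)) @` `]0, l2[).
  apply: connected_continuous_connected; first exact/connected_intervalP/interval_is_interval.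
  apply: continuous_subspaceT => y.
  exact: (@cvg_pair _ _ _ _ (nbhs x) (nbhs y) _ _ _ _ _ (cvg_cst x) cvg_id).
have c1 : 0 < l1 / 2 < l1 by have := l10; lra.
have c2 : 0 < l2 / 2 < l2 by have := l20; lra.
have -> : rectangle = \bigcup_(y in `]0, l2[)
    ((fun t : R => (t, y)) @` `]0, l1[ `|` (fun t : R => (l1 / 2, t)) @` `]0, l2[).
  apply/seteqP; split=> [[x y] [/= hx hy]|[x y] [t ht]].
    by exists y => //; left; exists x.
  by case=> -[s hs [<- <-]]; split => //=; rewrite in_itv.
apply: bigcup_connected.
  exists (l1 / 2, l2 / 2) => y _; by right; exists (l2 / 2); rewrite //= in_itv.
move=> y hy; apply: connectedU => //.
by exists (l1 / 2, y); split; [exists (l1 / 2); rewrite //= in_itv|exists y].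
Qed.

Lemma bounded_domain_rectangle : bounded_domain rectangle.
Proof.
split; [exact: open_rectangle|exact: connected_rectangle| |].
  by exists (l1 / 2, l2 / 2); split; rewrite /= in_itv/=; [have := l10|have := l20]; lra.
exists (l1 + l2); split; first exact: num_real.
move=> M lM [x y] [/= hx hy]; move: hx hy; rewrite !in_itv/= => /andP[x0 x1] /andP[y0 y1].
by rewrite prod_normE/= ge_max !gtr0_norm//; have := l10; have := l20; lra.
Qed.

End rectangle.

(** * Lower bound on the eigenvalue *)

Section lower_bound.
Context {R : realType}.
Local Notation RR := (measurableTypeR R * measurableTypeR R)%type.

(** The integral of a nonnegative function is a supremum over the simple functions below it, hence
    monotone without measurability. This allows comparison with the integral of [H (g x) ^ p]
    directly. *)
Lemma ge0_le_integral_nonmeasurable d (T : measurableType d)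
    (mu : {measure set T -> \bar R}) (D : set T) (f g : T -> \bar R) :
  (forall x, D x -> 0 <= f x)%E -> (forall x, D x -> f x <= g x)%E ->
  (\int[mu]_(x in D) f x <= \int[mu]_(x in D) g x)%E.
Proof.
move=> f0 fg; rewrite (integral_mkcond D f) (integral_mkcond D g).
have le x : ((f \_ D) x <= (g \_ D) x)%E by apply: lee_restrict.
have ge0 x : (0 <= (f \_ D) x)%E by exact: erestrict_ge0.
rewrite !ge0_integralTE//; last by move=> x; exact: le_trans (ge0 x) (le x).
by apply: le_ereal_sup => _ [h hf <-]; exists h => //= x; exact: le_trans (hf x) _.
Qed.

Lemma powRD_le (p x y : R) : 0 <= p -> 0 <= x -> 0 <= y ->
  (x + y) `^ p <= 2 `^ p * (x `^ p + y `^ p).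
Proof.
move=> p0; wlog xy : x y / x <= y.
  move=> hw x0 y0; have [|/ltW] := leP x y; first by move=> ?; exact: hw.
  by move=> yx; rewrite addrC [X in _ * X]addrC; exact: hw.
move=> x0 y0; apply: (@le_trans _ _ ((2 * y) `^ p)).
  by apply: ge0_ler_powR; rewrite ?nnegrE ?mulr_ge0 ?addr_ge0//; lra.
by rewrite powRM// ler_wpM2l ?powR_ge0// lerDr powR_ge0.
Qed.

Lemma ppowD_le (p r s : R) : 0 <= p ->
  ppow p (r + s) <= 2 `^ p * (ppow p r + `|s| `^ p).
Proof.
move=> p0; have m0 : 0 <= Num.max r 0 by rewrite le_max lexx orbT.
apply: le_trans (powRD_le p0 m0 (normr_ge0 s)).
apply: ge0_ler_powR => //; rewrite ?nnegrE ?addr_ge0// ?le_max ?lexx ?orbT//.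
rewrite ge_max addr_ge0// andbT lerD ?ler_norm//.
by rewrite le_max lexx.
Qed.

Lemma Lpnorm_powR (p : R) (Omega : set RR) (f : R * R -> R) : 0 < p ->
  (Lpnorm p Omega f `^ p = \int[leb2]_(z in Omega) (`|f z| `^ p)%:E)%E.
Proof.
move=> p0; rewrite /Lpnorm powR_Lnorm ?gt_eqF// [RHS]integral_mkcond.
apply: eq_integral => z _; rewrite /= !patchE; case: ifPn => // _.
by rewrite normr0 powR0 ?gt_eqF.
Qed.

Lemma le_Lpnorm_integral (p e : R) (Omega : set RR) (f : R * R -> R) :
  0 < p -> 0 < e -> (Lpnorm p Omega f <= (e `^ p^-1)%:E)%E ->
  (\int[leb2]_(z in Omega) (`|f z| `^ p)%:E <= e%:E)%E.
Proof.
move=> p0 e0 fe; rewrite -Lpnorm_powR//.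
have -> : e%:E = ((e `^ p^-1)%:E `^ p)%E.
  by rewrite poweR_EFin -powRrM mulVf ?gt_eqF// powRr1// ltW.
apply: gt0_ler_poweR fe; first exact: ltW.
  by rewrite in_itv/= leey andbT Lnorm_ge0.
by rewrite in_itv/= leey andbT lee_fin powR_ge0.
Qed.

Lemma W01p_approx (p e : R) (Omega : set RR) u g : 0 < p -> 0 < e ->
  W01p p Omega u g -> exists2 phi, test_function Omega phi &
  [/\ \int[leb2]_(z in Omega) (`|u z - phi z| `^ p)%:E <= e%:E,
      \int[leb2]_(z in Omega) (`|(g z).1 - partial1 phi z| `^ p)%:E <= e%:E &
      \int[leb2]_(z in Omega) (`|(g z).2 - partial2 phi z| `^ p)%:E <= e%:E]%E.
Proof.
(* The tolerance [e ^ (1/p)] on norms becomes [e] on integrals of [p]-th powers. *)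
move=> p0 e0 [_ /(_ (e `^ p^-1) (powR_gt0 _ e0))[phi tphi]].
rewrite /W1p_norm => /ltW le; exists phi => //.
have n0 f : (0 <= Lpnorm p Omega f)%E by exact: Lnorm_ge0.
split; apply: le_Lpnorm_integral => //; apply: le_trans le.
- by rewrite -addeA leeDl// adde_ge0.
- by rewrite addeAC leeDr// adde_ge0.
- by rewrite leeDr// adde_ge0.
Qed.

Lemma in_Lp_measurable (p : R) (Omega : set RR) (u : R * R -> R) : measurable Omega ->
  in_Lp p Omega u -> measurable_fun Omega u.
Proof.
move=> mO /sub_Lfun_mfun; rewrite inE/= => mu.
by apply/(measurable_restrictT (u : RR -> R) mO); exact: mu.
Qed.

Lemma measurable_powR_norm (p : R) (D : set RR) (f : R * R -> R) :
  measurable_fun D f -> measurable_fun D (fun z => (`|f z| `^ p)%:E).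
Proof.
move=> mf; apply/measurable_EFinP.
apply: (measurableT_comp (measurable_powR _)).
exact: measurableT_comp.
Qed.

Lemma measurable_ppow (p : R) (D : set RR) (f : R * R -> R) :
  measurable_fun D f -> measurable_fun D (fun z => (ppow p (f z))%:E).
Proof.
move=> mf; apply/measurable_EFinP.
apply: (measurableT_comp (measurable_powR _)).
by apply: measurable_maxr.
Qed.

(** * From test functions to the Sobolev space *)

Section transfer.
Variables (p a b K : R) (Omega : set RR).
Hypotheses (p1 : 1 < p) (K0 : 0 <= K) (mO : measurable Omega).
Hypothesis poincareO : forall phi, test_function Omega phi ->
  (\int[leb2]_z (`|phi z| `^ p)%:E <=
   K%:E * \int[leb2]_z (ppow p (a * partial1 phi z + b * partial2 phi z))%:E)%E.

(** A test function approximates [u]. Passing from [u] to [phi], then from the gradient of [phi]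
    back to [g], costs a factor [2 ^ p] each time, whence [4 ^ p]; the errors are arbitrarily
    small. *)
Lemma poincare_W01p u g : W01p p Omega u g -> Lpnorm p Omega u = 1%E ->
  (1 <= (4 `^ p * K)%:E *
    \int[leb2]_(z in Omega) (ppow p (a * (g z).1 + b * (g z).2))%:E)%E.
Proof.
move=> wug u1; have p0 : 0 < p by exact: lt_trans ltr01 p1.
have [mu mg1 mg2] : [/\ measurable_fun Omega u, measurable_fun Omega (fst \o g) &
    measurable_fun Omega (snd \o g)].
  have [[iu ig1 ig2 _] _] := wug; split.
  - exact: in_Lp_measurable mO iu.
  - exact: in_Lp_measurable mO ig1.
  - exact: in_Lp_measurable mO ig2.
have intu : (\int[leb2]_(z in Omega) (`|u z| `^ p)%:E = 1)%E.
  by rewrite -Lpnorm_powR// u1 poweR1r.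
set X := (X in (_ <= _ * X)%E).
(* [C] is the total coefficient of the approximation error [d] once the three steps below are
   chained, so [d = e / C] gives a final error of exactly [e]. *)
pose C := 2 `^ p * (1 + K * (2 `^ p * (2 `^ p * (`|a| `^ p + `|b| `^ p)))).
have C0 : 0 < C.
  apply: mulr_gt0; first exact: powR_gt0.
  by apply: ltr_pwDl => //; rewrite ?(mulr_ge0, addr_ge0, powR_ge0).
apply/lee_addgt0Pr => e e0.
have [phi tphi [I0 I1 I2]] := W01p_approx p0 (divr_gt0 e0 C0) wug.
set d := e / C in I0 I1 I2.
have [sphi _ sO] := tphi.
have mphi : measurable_fun Omega phi.
  apply: measurable_funTS; apply: continuous_measurable_plane.
  exact: continuous_smooth.
have md1 : measurable_fun Omega (partial1 phi).
  apply: measurable_funTS; apply: continuous_measurable_plane.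
  exact: continuous_partial1.
have md2 : measurable_fun Omega (partial2 phi).
  apply: measurable_funTS; apply: continuous_measurable_plane.
  exact: continuous_partial2.
have offO z : ~ Omega z -> [/\ phi z = 0, partial1 phi z = 0 & partial2 phi z = 0].
  by move=> zO; apply: not_supp_eq0 => /sO.
have step1 : (1 <= (2 `^ p)%:E * (d%:E + \int[leb2]_(z in Omega) (`|phi z| `^ p)%:E))%E.
  rewrite -intu.
  apply: (@le_trans _ _ (\int[leb2]_(z in Omega) ((2 `^ p)%:E *
      ((`|u z - phi z| `^ p)%:E + (`|phi z| `^ p)%:E)))%E).
    apply: ge0_le_integral_nonmeasurable => z _; first by rewrite lee_fin powR_ge0.
    rewrite -EFinD -EFinM lee_fin; apply: le_trans (powRD_le _ _ _) => //; last exact: ltW.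
    apply: ge0_ler_powR; rewrite ?nnegrE ?addr_ge0//; first exact: ltW.
    by rewrite -[u z in leLHS](subrK (phi z)) ler_normD.
  rewrite ge0_integralZl//; last 2 first.
  - by apply: emeasurable_funD; apply: measurable_powR_norm => //; exact: measurable_funB.
  - by move=> z _; rewrite adde_ge0// lee_fin powR_ge0.
  rewrite lee_wpmul2l ?lee_fin ?powR_ge0// ge0_integralD//; last 2 first.
  - by apply: measurable_powR_norm; exact: measurable_funB.
  - exact: measurable_powR_norm.
  by rewrite leeD2r.
have step2 : (\int[leb2]_(z in Omega) (`|phi z| `^ p)%:E <=
  K%:E * \int[leb2]_(z in Omega) (ppow p (a * partial1 phi z + b * partial2 phi z))%:E)%E.
  rewrite integral_mkcond [X in (_ * X)%E]integral_mkcond.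
  have := poincareO tphi; congr (_ <= _ * _)%E; apply: eq_integral => z _.
    rewrite patchE; case: ifPn => //; rewrite notin_setE => /offO[-> _ _].
    by rewrite normr0 powR0// gt_eqF.
  rewrite patchE; case: ifPn => //; rewrite notin_setE => /offO[_ -> ->].
  by rewrite !mulr0 addr0 ppow_neg.
have step3 : (\int[leb2]_(z in Omega) (ppow p (a * partial1 phi z + b * partial2 phi z))%:E
    <= (2 `^ p)%:E * (X + (2 `^ p * (`|a| `^ p + `|b| `^ p) * d)%:E))%E.
  pose r1 z := (g z).1 - partial1 phi z.
  pose r2 z := (g z).2 - partial2 phi z.
  have mr1 : measurable_fun Omega r1 by exact: measurable_funB.
  have mr2 : measurable_fun Omega r2 by exact: measurable_funB.
  have mX : measurable_fun Omega (fun z => (ppow p (a * (g z).1 + b * (g z).2))%:E).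
    by apply: measurable_ppow; apply: measurable_funD; apply: measurable_funM.
  have n0 (c : R) : (0 <= (c `^ p)%:E)%E by rewrite lee_fin powR_ge0.
  pose E z := ((2 `^ p)%:E * ((`|a| `^ p)%:E * (`|r1 z| `^ p)%:E
     + (`|b| `^ p)%:E * (`|r2 z| `^ p)%:E))%E.
  have E0 z : (0 <= E z)%E by rewrite /E mule_ge0// adde_ge0// mule_ge0.
  have m1 : measurable_fun Omega (fun z => ((`|a| `^ p)%:E * (`|r1 z| `^ p)%:E)%E).
    by apply: measurable_funeM; exact: measurable_powR_norm.
  have m2 : measurable_fun Omega (fun z => ((`|b| `^ p)%:E * (`|r2 z| `^ p)%:E)%E).
    by apply: measurable_funeM; exact: measurable_powR_norm.
  have mE : measurable_fun Omega E.
    exact: (measurable_funeM _ (emeasurable_funD m1 m2)).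
  apply: (@le_trans _ _ (\int[leb2]_(z in Omega) ((2 `^ p)%:E *
      ((ppow p (a * (g z).1 + b * (g z).2))%:E + E z)))%E).
    apply: ge0_le_integral_nonmeasurable => z _; first by rewrite lee_fin ppow_ge0.
    rewrite /E/= -!(EFinM, EFinD) lee_fin.
    have -> : a * partial1 phi z + b * partial2 phi z =
      a * (g z).1 + b * (g z).2 + (- (a * r1 z) - b * r2 z) by rewrite /r1 /r2; ring.
    apply: (le_trans (ppowD_le _ _ (ltW p0))).
    rewrite ler_wpM2l ?powR_ge0// lerD2l -!powRM//.
    apply: le_trans (powRD_le _ _ _); rewrite ?mulr_ge0//; last exact: ltW.
    apply: ge0_ler_powR; rewrite ?nnegrE ?addr_ge0 ?mulr_ge0//; first exact: ltW.
    by rewrite -!normrM (le_trans (ler_normB _ _))// normrN.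
  rewrite ge0_integralZl//; last 2 first.
  - exact: (emeasurable_funD mX mE).
  - by move=> z _; rewrite adde_ge0// lee_fin ppow_ge0.
  rewrite lee_wpmul2l// ge0_integralD//; last by move=> z _; rewrite lee_fin ppow_ge0.
  rewrite leeD2l//.
  have E1 : (\int[leb2]_(z in Omega) ((`|a| `^ p)%:E * (`|r1 z| `^ p)%:E) <=
      (`|a| `^ p)%:E * d%:E)%E.
    rewrite (ge0_integralZl leb2 mO (measurable_powR_norm p mr1) (fun z _ => n0 _) (n0 _)).
    by apply: (lee_wpmul2l (n0 _)); exact: I1.
  have E2 : (\int[leb2]_(z in Omega) ((`|b| `^ p)%:E * (`|r2 z| `^ p)%:E) <=
      (`|b| `^ p)%:E * d%:E)%E.
    rewrite (ge0_integralZl leb2 mO (measurable_powR_norm p mr2) (fun z _ => n0 _) (n0 _)).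
    by apply: (lee_wpmul2l (n0 _)); exact: I2.
  rewrite (ge0_integralZl leb2 mO (emeasurable_funD m1 m2)) => [|z _|]; last exact: n0.
  - rewrite (ge0_integralD leb2 mO _ m1 _ m2) => [|z _|z _]; [|exact: mule_ge0..].
    have -> : ((2 `^ p * (`|a| `^ p + `|b| `^ p) * d)%:E = (2 `^ p)%:E *
        ((`|a| `^ p)%:E * d%:E + (`|b| `^ p)%:E * d%:E))%E.
      by rewrite -!(EFinD, EFinM); congr EFin; ring.
    by apply: lee_wpmul2l; [exact: n0|exact: leeD].
  - by apply: adde_ge0; exact: mule_ge0.
apply: (le_trans step1).
have X0 : (0 <= X)%E by apply: integral_ge0 => z _; rewrite lee_fin ppow_ge0.
apply: (@le_trans _ _ ((2 `^ p)%:E * (d%:E + K%:E * ((2 `^ p)%:E *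
    (X + (2 `^ p * (`|a| `^ p + `|b| `^ p) * d)%:E)))))%E.
  rewrite lee_wpmul2l ?lee_fin ?powR_ge0// leeD2l//; apply: (le_trans step2).
  by rewrite lee_wpmul2l.
have four : 4 `^ p = 2 `^ p * 2 `^ p :> R by rewrite -powRM//; congr (_ `^ _); ring.
have eC : e = C * d by rewrite /d; field; rewrite gt_eqF.
move: X X0 {step3} => [x| |]//.
  rewrite lee_fin => x0; rewrite -!(EFinD, EFinM) lee_fin eC /C four.
  by rewrite le_eqVlt; apply/orP; left; apply/eqP; ring.
(* Here the integral is infinite. If [K = 0], the convention that 0 times infinity is 0 leaves
   [2 ^ p * d <= e]; otherwise the right-hand side is infinite. *)
move=> _; have [K00|Kp] := eqVneq K 0.
  rewrite K00 mulr0 !mul0e adde0 add0e -EFinM lee_fin eC /C K00 mul0r addr0 mulr1//.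
rewrite [X in (_ <= X + _)%E]gt0_muley ?addye ?leey//.
by rewrite lte_fin mulr_gt0 ?powR_gt0// lt_neqAle eq_sym Kp.
Qed.

End transfer.

(** The oscillation of the linear form is [2 w], so [poincare] has constant [(4 p w / c) ^ p], and
    the factor [4 ^ p] of [poincare_W01p] turns 4 into 16. The positive part of the form [(a, b)] is
    below [H], as [H] is nonnegative. *)
Lemma lambda_lower_bound (p a b al be w r : R) (H : R * R -> R) (Omega : set RR) :
  1 < p -> measurable Omega -> 0 <= r -> 0 <= w ->
  (forall z, 0 <= H z) -> (forall z, a * z.1 + b * z.2 <= H z) ->
  0 < a * al + b * be ->
  (forall z, Omega z -> - w <= al * z.1 + be * z.2 <= w) ->
  r * (16 * p * w / (a * al + b * be)) `^ p <= 1 ->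
  (r%:E <= lambda p H Omega)%E.
Proof.
move=> p1 mO r0 w0 H0 aH c0 qw rw; have p0 : 0 < p by exact: lt_trans ltr01 p1.
apply: le_ereal_inf_tmp => _ [u [g [wug u1 ->]]].
set c := a * al + b * be in c0 rw.
have K0 : 0 <= (2 * p * (w - - w) / c) `^ p by exact: powR_ge0.
have poin phi := @poincare R p a b al be (- w) w Omega phi p1 c0 qw.
have := poincare_W01p p1 K0 mO poin wug u1.
set X := (X in (_ <= _ * X)%E) => le1.
have XH : (X <= \int[leb2]_(x in Omega) (H (g x) `^ p)%:E)%E.
  apply: ge0_le_integral_nonmeasurable => z _; first by rewrite lee_fin ppow_ge0.
  rewrite lee_fin -(ppow_pos p (H0 _)); apply: le_ppow; [exact: ltW|exact: aH].
apply: le_trans XH.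
have X0 : (0 <= X)%E by apply: integral_ge0 => z _; rewrite lee_fin ppow_ge0.
have r0E : (0 <= r%:E)%E by rewrite lee_fin.
have := lee_wpmul2l r0E le1; rewrite mule1 => /le_trans; apply.
rewrite muleA -EFinM -[leRHS]mul1e; apply: lee_wpmul2r => //.
rewrite lee_fin -powRM//; last by rewrite divr_ge0 ?(ltW c0)// !mulr_ge0 ?(ltW p0)//; lra.
apply: le_trans rw; rewrite le_eqVlt; apply/orP; left; apply/eqP.
by congr (_ * _ `^ _); field; rewrite gt_eqF.
Qed.

End lower_bound.

Lemma le_lambda_rectangle (R : realType) (p a b r : R) (H : R * R -> R) :
  1 < p -> 0 <= r -> (forall z, 0 <= H z) ->
  (forall z, a * z.1 + b * z.2 <= H z) -> (a != 0) || (b != 0) ->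
  exists l1 l2 : R, [/\ 0 < l1, 0 < l2, l1 * l2 = 1 &
    (r%:E <= lambda p H (rectangle l1 l2))%E].
Proof.
move=> p1 r0 H0 aH ab; have p0 : 0 < p by exact: lt_trans ltr01 p1.
(* As [t <= 1] and [p > 1], one has [r * t ^ p <= r * t <= 1]. *)
pose t := (1 + r)^-1.
have t01 : 0 < t <= 1 by rewrite invr_gt0 invf_le1; lra.
have rt : r * t `^ p <= 1.
  apply: (@le_trans _ _ (r * t)).
    by rewrite ler_wpM2l// ge1r_powR// ltW.
  by rewrite ler_pdivrMr; lra.
have [t0 _] := andP t01.
have size (c : R) : c != 0 -> exists L : R, 0 < L /\
    r * (16 * p * (`|c| * L) / (c * c)) `^ p <= 1.
  (* This width makes the base of the power equal to [t]. *)
  rewrite -normr_gt0 => c0; exists (`|c| * t / (16 * p)); split.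
    by rewrite divr_gt0 ?mulr_gt0.
  rewrite [X in X `^ p](_ : _ = t)//.
  have -> : c * c = `|c| * `|c| by rewrite -normrM ger0_norm// -expr2 sqr_ge0.
  by field; rewrite !gt_eqF.
have mO l1 l2 : measurable
    (rectangle l1 l2 : set (measurableTypeR R * measurableTypeR R)%type).
  by apply: measurableX; exact: measurable_itv.
have bnd (c L x : R) : 0 < x -> x < L -> - (`|c| * L) <= c * x <= `|c| * L.
  move=> x0 xL; rewrite -ler_norml normrM (gtr0_norm x0).
  by rewrite ler_wpM2l// ltW.
have cc (c : R) : c != 0 -> 0 < c * c.
  by move=> c0; rewrite -expr2 exprn_even_gt0.
case/orP : ab => c0; have [L [L0 hL]] := size _ c0.
(* The rectangle is thin in a direction where the form [(a, b)] does not vanish; the other side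
   restores the area 1. *)
- exists L, L^-1; split; rewrite ?invr_gt0 ?mulfV ?gt_eqF//.
  apply: (@lambda_lower_bound _ p a b a 0 (`|a| * L)) => //; rewrite ?mulr0 ?addr0 ?cc//.
    by rewrite mulr_ge0// ltW.
  move=> [x y] [/= + _]; rewrite in_itv/= mul0r addr0 => /andP[x0 xL].
  exact: bnd.
- exists L^-1, L; split; rewrite ?invr_gt0 ?mulVf ?gt_eqF//.
  apply: (@lambda_lower_bound _ p a b 0 b (`|b| * L)) => //; rewrite ?mulr0 ?add0r ?cc//.
    by rewrite mulr_ge0// ltW.
  move=> [x y] [/= _]; rewrite in_itv/= mul0r add0r => /andP[y0 yL].
  exact: bnd.
Qed.

Theorem theorem5p1 (R : realType) (p : R) (hp : 1 < p) (H : R * R -> R)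
    (hH : H \in scrH `\ (cst 0 : R * R -> R)) :
  ereal_sup [set lambda p H Omega | Omega in
    [set Omega : set (R * R) | bounded_domain Omega /\ leb2 Omega = 1%E]] = +oo%E.
Proof.
move: hH; rewrite inE => -[sH /= /eqP nH].
have [a [b [ab aH]]] := scrH_minorant sH nH; have [H0 _ _] := sH.
(* It suffices that the supremum exceeds every positive real [r]; a rectangle adapted to [r] shows
   it. *)
apply/eqyP => r r0.
have [l1 [l2 [l10 l20 l12 le]]] := le_lambda_rectangle hp (ltW r0) H0 aH ab.
apply: (le_trans le); apply: ereal_sup_ubound.
exists (rectangle l1 l2) => //; split; first exact: bounded_domain_rectangle.
by rewrite leb2_rectangle// l12.
Qed.
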